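(* Let $A\in\mathbb{R}^{n\times n}$, $B\in\mathbb{R}^{n\times m}$, let $C\in\mathbb{R}^{p\times n}$ have full row rank $p$, and let $C^-$ be a generalized inverse of $C$. Consider the system $\dot{x}(t)=Ax(t)+Bu(t)$, $y(t)=Cx(t)$. The static output feedback control law $u(t)=-Zy(t)$, $Z\in\mathbb{R}^{m\times p}$, can drive the linear functional $y(t)\to\mathbf{0}$ as $t\to\infty$ at an arbitrary rate of convergence from any initial condition $y(t_0)$ by placing $p$ poles of a subsystem of order $p$ at any desired set $\Lambda=\{\lambda_1,\dots,\lambda_p\}$, where $\lambda_i\in\mathbb{C}$, $i\in\{1,\dots,p\}$, if and only if the following conditions are satisfied: $$\operatorname{rank}\begin{pmatrix}CA\\C\end{pmatrix}=\operatorname{rank}(C),$$ $$\operatorname{rank}\begin{pmatrix}sC-CA & CB\end{pmatrix}=\operatorname{rank}(C)=p\quad\text{for all } s\in\mathbb{C}.$$ The gain $Z$ is determined using a pole placement method such that $\mathrm{eig}(CAC^--CBZ)=\Lambda$. Moreover, $\Lambda$ is a subset of the eigenvalues of $A-BZC$.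
   Context: Here $x(t)\in\mathbb{R}^n$ is the state, $u(t)\in\mathbb{R}^m$ the input and $y(t)\in\mathbb{R}^p$ the measured output. A generalized inverse $X^-$ of a matrix $X$ is a matrix satisfying $XX^-X=X$, and $\mathrm{eig}(X)$ denotes the set of eigenvalues of $X$. Pre-multiplying the state equation by $C$ gives $\dot{y}(t)=CAC^-y(t)+CA(I-C^-C)x(t)+CBu(t)$. The first rank condition is equivalent to $CA(I-C^-C)=\mathbf{0}$; when it holds, the subsystem of order $p$ is $\dot{y}(t)=CAC^-y(t)+CBu(t)$, which under $u(t)=-Zy(t)$ becomes $\dot{y}(t)=(CAC^--CBZ)y(t)$.
   Formalization: The desired set Λ is required to be closed under complex conjugation, counted with multiplicity; for arbitrary λ_i ∈ ℂ the claim fails, since Z is real (e.g. n=m=p=1, A=0, B=C=1, Λ={i}). *)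

(* Defs.v *)
From mathcomp Require Import all_boot all_order all_algebra.
From mathcomp Require Import complex.
From mathcomp Require Import all_classical all_reals all_analysis.

Set Implicit Arguments.
Unset Strict Implicit.
Unset Printing Implicit Defensive.

Import Order.TTheory GRing.Theory Num.Theory.
Import numFieldNormedType.Exports.

Local Open Scope classical_set_scope.
Local Open Scope ring_scope.
Local Open Scope complex_scope.

Definition is_ginv (F : fieldType) (m n : nat) (X : 'M[F]_(m, n))
  (Y : 'M[F]_(n, m)) : Prop := X *m Y *m X = X.

Definition to_complex (R : realType) (m n : nat) (M : 'M[R]_(m, n)) :
  'M[R[i]]_(m, n) := map_mx (real_complex R) M.

Definition alg_mult (F : fieldType) (n : nat) (M : 'M[F]_n) (a : F) : nat :=
  mup a (char_poly M).

Lemma alg_mult_gt0 (F : fieldType) (n : nat) (M : 'M[F]_n) (a : F) :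
  (0 < alg_mult M a)%N = eigenvalue M a.
Proof.
rewrite eigenvalue_root_char -XsubC_dvd ?monic_neq0 ?char_poly_monic //.
by rewrite dvdp_XsubCl.
Qed.

(* Spectra are multisets: a tuple of n numbers is the spectrum of an n x n
   matrix when every number occurs in it as often as its algebraic
   multiplicity (hence not at all if it is not an eigenvalue). *)
Definition eig_is (R : realType) (n : nat) (M : 'M[R]_n)
    (L : n.-tuple R[i]) : Prop :=
  forall a : R[i], alg_mult (to_complex M) a = count_mem a L.

Definition eig_contains (R : realType) (n p : nat) (M : 'M[R]_n)
    (L : p.-tuple R[i]) : Prop :=
  forall a : R[i], (count_mem a L <= alg_mult (to_complex M) a)%N.

(* Closed under complex conjugation, with multiplicities: the poles of a real
   system always are, so only such multisets are candidates for placement. *)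
Definition self_conjugate (R : realType) (p : nat) (L : p.-tuple R[i]) : Prop :=
  perm_eq [seq a^* | a <- L] L.

(* x is continuous on [t0, +oo[ and x'(t) = f(t) for t > t0. The derivative is
   taken entrywise, since column vectors of possibly null size carry no norm
   in the library. *)
Definition solves_from (R : realType) (n : nat) (t0 : R)
    (x f : R -> 'cV[R]_n) : Prop :=
  forall i : 'I_n,
    {within [set t | t0 <= t], continuous (fun t : R => x t i 0)} /\
    (forall t : R, t0 < t -> is_derive t 1 (fun s : R => x s i 0) (f t i 0)).

Definition trajectory (R : realType) (n m : nat) (A : 'M[R]_n)
    (B : 'M[R]_(n, m)) (t0 : R) (x : R -> 'cV[R]_n) (u : R -> 'cV[R]_m) : Prop :=
  solves_from t0 x (fun t => A *m x t + B *m u t).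

(* State trajectories under u(t) = - Z y(t) with y(t) = C x(t); the initial
   state x(t0) is arbitrary. *)
Definition sof_trajectory (R : realType) (n m p : nat) (A : 'M[R]_n)
    (B : 'M[R]_(n, m)) (C : 'M[R]_(p, n)) (Z : 'M[R]_(m, p))
    (t0 : R) (x : R -> 'cV[R]_n) : Prop :=
  trajectory A B t0 x (fun t => - (Z *m (C *m x t))).

Definition vanishes_at_rate (R : realType) (p : nat) (r : R)
    (y : R -> 'cV[R]_p) : Prop :=
  forall i : 'I_p,
    ((fun t : R => y t i 0) @ +oo --> (0 : R)) /\
    ((fun t : R => expR (r * t) * y t i 0) @ +oo --> (0 : R)).

(* The output obeys the autonomous order-p subsystem y' = H y. *)
Definition output_subsystem (R : realType) (n m p : nat) (A : 'M[R]_n)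
    (B : 'M[R]_(n, m)) (C : 'M[R]_(p, n)) (Z : 'M[R]_(m, p))
    (H : 'M[R]_p) : Prop :=
  forall (t0 : R) (x : R -> 'cV[R]_n), sof_trajectory A B C Z t0 x ->
    solves_from t0 (fun t => C *m x t) (fun t => H *m (C *m x t)).

(* Z places the p poles of an order-p subsystem governing the output at L, and
   the output tends to 0 from every initial condition at every rate r > 0 that
   L allows, i.e. such that all of L lies in Re < - r. *)
Definition sof_places (R : realType) (n m p : nat) (A : 'M[R]_n)
    (B : 'M[R]_(n, m)) (C : 'M[R]_(p, n)) (Z : 'M[R]_(m, p))
    (L : p.-tuple R[i]) : Prop :=
  (exists H : 'M[R]_p, output_subsystem A B C Z H /\ eig_is H L) /\
  (forall r : R, 0 < r -> (forall a, a \in L -> complex.Re a < - r) ->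
   forall (t0 : R) (x : R -> 'cV[R]_n), sof_trajectory A B C Z t0 x ->
     vanishes_at_rate r (fun t => C *m x t)).

Definition sof_assignable (R : realType) (n m p : nat) (A : 'M[R]_n)
    (B : 'M[R]_(n, m)) (C : 'M[R]_(p, n)) : Prop :=
  forall L : p.-tuple R[i], self_conjugate L ->
    exists Z : 'M[R]_(m, p), sof_places A B C Z L.

Definition rank_conditions (R : realType) (n m p : nat) (A : 'M[R]_n)
    (B : 'M[R]_(n, m)) (C : 'M[R]_(p, n)) : Prop :=
  \rank (col_mx (C *m A) C) = \rank C /\
  (forall s : R[i],
     \rank (row_mx (s *: to_complex C - to_complex (C *m A))
                   (to_complex (C *m B))) = \rank C /\
     \rank C = p).

(* Main.v *)
Require Import Defs.
From mathcomp Require Import all_boot all_order all_algebra.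
From mathcomp Require Import complex.
From mathcomp Require Import all_classical all_reals all_analysis.
From mathcomp Require Import ring lra.

Set Implicit Arguments.
Unset Strict Implicit.
Unset Printing Implicit Defensive.

Import Order.TTheory GRing.Theory Num.Theory.
Import numFieldNormedType.Exports.

Local Open Scope classical_set_scope.
Local Open Scope ring_scope.

(** Since C has full row rank, C C^- = 1, and the first rank condition says
    that CA = H0 C with H0 = CAC^-. Because every initial state starts a
    trajectory, the output obeys y' = H y exactly when C(A - BZC) = HC, which
    forces both CA = H0 C and H = H0 - CBZ. As sC - CA = (s - H0)C, the second
    rank condition is then the Popov-Belevitch-Hautus test for (H0, CB): if it
    fails at s, then s is an eigenvalue of H0 - CBZ for all Z and cannot be
    moved; if it holds, poles are placed by Heymann's reduction to a single
    input followed by Ackermann's formula. Decay comes from Cayley-Hamilton: for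
    a functional v, the functions w_k = v (H - a_1) ... (H - a_k) y satisfy
    w_k' = a_(k+1) w_k + w_(k+1), and the last one is 0. *)

(** * Pole placement over a field *)

Lemma char_poly_trmx (F : comNzRingType) (n : nat) (A : 'M[F]_n) :
  char_poly A^T = char_poly A.
Proof.
rewrite /char_poly -[in RHS]det_tr; congr (\det _).
by apply/matrixP => i j; rewrite !mxE eq_sym.
Qed.

Lemma horner_mx_sum (F : comNzRingType) (n : nat) (A : 'M[F]_n.+1) d
    (q : {poly F}) : (size q <= d)%N ->
  horner_mx A q = \sum_(i < d) q`_i *: A ^+ i.
Proof.
move=> sq; rewrite (_ : q = \poly_(i < d) q`_i); last first.
  apply/polyP => i; rewrite coef_poly; case: ltnP => // di.
  by rewrite nth_default // (leq_trans sq).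
rewrite poly_def raddf_sum; apply: eq_bigr => i _.
rewrite -poly_def coef_poly ltn_ord /=.
by rewrite horner_mxZ rmorphXn /= horner_mx_X.
Qed.

Section PolePlacement.
Variables (F : fieldType) (n m : nat) (A : 'M[F]_n) (C : 'M[F]_(m, n)).

(** States of the discrete-time system x_(k+1) = x_k A + u_(k+1) C started from x_0 = u_0 C. States
    and inputs are rows, so [C] is an input matrix here and the pair is the transpose of the usual
    one. *)
Fixpoint driven (u : nat -> 'rV[F]_m) (k : nat) : 'rV[F]_n :=
  if k is k'.+1 then driven u k' *m A + u k'.+1 *m C else u 0%N *m C.

Lemma eq_driven (u v : nat -> 'rV[F]_m) (k : nat) :
  (forall i, (i <= k)%N -> u i = v i) -> driven u k = driven v k.
Proof.
elim: k => [|k IH] uv /=; first by rewrite uv.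
by rewrite uv // IH // => i ik; apply: uv; rewrite (leq_trans ik).
Qed.

(* Heymann's lemma: as long as the rows found so far do not span an invariant
   space containing C, some input leads out of their span. *)
Lemma driven_free :
  (forall V : 'M[F]_n, (C <= V)%MS -> (V *m A <= V)%MS -> row_full V) ->
  forall k, (k <= n)%N -> exists u, row_free (\matrix_(i < k) driven u i).
Proof.
move=> ctrb; elim=> [|k IH] kn.
  by exists (fun=> 0); rewrite -row_leq_rank.
have [u fu] := IH (ltnW kn); set X := (\matrix_(i < k) driven u i) in fu.
(* Only the input at time k changes, so the earlier states stay the same. *)
pose u' w i := if i == k then w else u i.
have u'E w i : (i < k)%N -> driven (u' w) i = driven u i.
  move=> ik; apply: eq_driven => j ji.
  by rewrite /u' ltn_eqF // (leq_ltn_trans ji).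
have [[w hw]|nw] := pselect (exists w, ~~ (driven (u' w) k <= X)%MS).
  exists (u' w); rewrite -row_leq_rank.
  set X' := \matrix_(i < _) _.
  have sub : (X + driven (u' w) k <= X')%MS.
    rewrite addsmx_sub; apply/andP; split; last first.
      by rewrite (_ : driven _ _ = row ord_max X') ?row_sub ?rowK.
    apply/row_subP => i; rewrite rowK -(u'E w) //.
    rewrite (_ : driven _ _ = row (widen_ord (leqnSn k) i) X') ?row_sub //.
    by rewrite rowK.
  apply: leq_trans (mxrankS sub).
  have : (X < X + driven (u' w) k)%MS.
    by rewrite /ltmx addsmxSl /= addsmx_sub submx_refl (negPf hw).
  by move/rank_ltmx; rewrite (eqP fu).
(* Otherwise the k-th state stays in the span of [X] whatever the input. Input 0 puts [base] there,
   differences put the rows of [C] there, and x_i A = x_(i+1) - u_(i+1) C makes the span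
   invariant. *)
have {}nw w : (driven (u' w) k <= X)%MS.
  by apply: contrapT => h; apply: nw; exists w; apply/negP.
pose base := if k is k'.+1 then driven u k' *m A else 0.
have drivenE w : driven (u' w) k = base + w *m C.
  have u'k : u' w k = w by rewrite /u' eqxx.
  rewrite /base; case: (k) u'k (u'E w) => [|k'] /= -> => [_|->] //.
  by rewrite add0r.
have hb : (base <= X)%MS by have := nw 0; rewrite drivenE mul0mx addr0.
have hC : (C <= X)%MS.
  apply/row_subP => i; have := nw (delta_mx 0 i); rewrite drivenE -rowE => h.
  by rewrite -[row i C](addKr base) addmx_sub // eqmx_opp.
have hA : (X *m A <= X)%MS.
  apply/row_subP => i; rewrite row_mul rowK.
  have [ik|] := ltnP i.+1 k.
    rewrite -[_ *m A](addrK (u i.+1 *m C)) addmx_sub //; last first.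
      by rewrite eqmx_opp mulmx_sub.
    by rewrite (_ : _ + _ = row (Ordinal ik) X) ?row_sub // rowK.
  move=> ki; have Ek : k = i.+1 by apply/eqP; rewrite eqn_leq ki ltn_ord.
  suff -> : driven u i *m A = base by [].
  by rewrite /base; move: (i : nat) Ek => j ->.
(* By hypothesis the span of [X] is then the whole space, although [X] has only k < n rows. *)
have := ctrb <<X>>%MS; rewrite !genmxE hC => /(_ isT).
rewrite (eqmxMr _ (genmxE X)) hA => /(_ isT).
rewrite /row_full genmxE => /eqP rX.
by have := rank_leq_row X; rewrite rX leqNgt kn.
Qed.

End PolePlacement.

(* Ackermann's formula. *)
Lemma char_poly_ackermann (F : fieldType) (n : nat) (A : 'M[F]_n.+1)
    (c : 'rV[F]_n.+1) (l : 'cV[F]_n.+1) (q : {poly F}) :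
  (forall i, (i <= n)%N -> c *m (A ^+ i *m l) = (i == n)%:R%:M) ->
  q \is monic -> size q = n.+2 ->
  char_poly (A - horner_mx A q *m l *m c) = q.
Proof.
move=> cl mq sq; set qA := horner_mx A q; set M := A - _.
have Mmul (w : 'cV_n.+1) : M *m w = A *m w - qA *m l *m (c *m w).
  by rewrite /M mulmxBl; congr (_ - _); rewrite !mulmxA.
(* As c A^k l = 0 for k < n, the rank-one feedback does not act on the vectors A^k l before k =
   n. *)
have Mpow k : (k <= n)%N -> M ^+ k *m l = A ^+ k *m l.
  elim: k => [|k IH] hk; first by rewrite !expr0.
  rewrite !exprS -!mulmxE -!mulmxA IH ?(ltnW hk) // Mmul cl ?(ltnW hk) //.
  by rewrite ltn_eqF // raddf0 mulmx0 subr0.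
have Mpoly (r : {poly F}) :
    (size r <= n.+1)%N -> horner_mx M r *m l = horner_mx A r *m l.
  move=> sr; rewrite !(horner_mx_sum _ sr) !mulmx_suml; apply: eq_bigr => i _.
  by rewrite -!scalemxAl Mpow // -ltnS.
(* The vector [l] is cyclic for [A]: if r has degree s, applying c A^(n-s) to r(A) l leaves only the
   leading coefficient of r. *)
have inj (r : {poly F}) : (size r <= n.+1)%N -> horner_mx A r *m l = 0 -> r = 0.
  move=> sr r0; apply/eqP; apply: contraT => rn0.
  have sr0 : (0 < size r)%N by rewrite size_poly_gt0.
  pose s := (size r).-1; have srE : size r = s.+1 by rewrite prednK.
  have sn : (s <= n)%N by rewrite -ltnS -srE.
  have : c *m (A ^+ (n - s) *m (horner_mx A r *m l)) = (r`_s)%:M.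
    rewrite (@horner_mx_sum _ _ _ s.+1) ?srE // mulmx_suml !mulmx_sumr.
    have term (i : 'I_s.+1) : c *m (A ^+ (n - s) *m (r`_i *: A ^+ i *m l))
        = r`_i *: ((n - s + i)%N == n)%:R%:M.
      have h : (n - s + i <= n)%N.
        by rewrite -[leqRHS](subnK sn) leq_add2l -ltnS.
      by rewrite -scalemxAl -!scalemxAr mulmxA -cl // exprD -mulmxE !mulmxA.
    rewrite big_ord_recr big1 => [|i _]; rewrite term /=.
      by rewrite add0r subnK // eqxx scalemx1.
    rewrite -[X in _ == X](subnK sn) eqn_add2l (ltn_eqF (ltn_ord i)).
    by rewrite raddf0 scaler0.
  rewrite r0 !mulmx0 => /esym/(congr1 (fun D : 'M[F]_1 => D 0 0)).
  rewrite !mxE eqxx mulr1n => /eqP; rewrite -[_ == 0]/(lead_coef r == 0).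
  by rewrite lead_coef_eq0 (negPf rn0).
have szd (p : {poly F}) :
    p \is monic -> size p = n.+2 -> (size (p - q)%R <= n.+1)%N.
  move=> mp sp; apply/leq_sizeP => j; rewrite leq_eqVlt => /orP[/eqP <-|hj].
    have := monicP mp; have := monicP mq.
    by rewrite !lead_coefE sp sq /= coefB => -> ->; rewrite subrr.
  by rewrite coefB !nth_default ?subrr // ?sp ?sq.
have szM : (size (char_poly M - q)%R <= n.+1)%N.
  by rewrite szd ?char_poly_monic ?size_char_poly.
have szr : (size (q - 'X^(n.+1))%R <= n.+1)%N.
  by rewrite -opprB size_polyN szd ?monicXn ?size_polyXn.
(* The difference of the two monic polynomials has degree at most n, so by cyclicity it need only
   kill [l], and at [A] and [M] it acts on [l] in the same way. At [M], Cayley-Hamilton leaves -q(M)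
   l. *)
apply/eqP; rewrite -subr_eq0; apply/eqP; apply: inj => //.
rewrite -Mpoly // rmorphB /= Cayley_Hamilton sub0r mulNmx.
suff -> : horner_mx M q *m l = 0 by rewrite oppr0.
have hq (B : 'M[F]_n.+1) : horner_mx B q = B ^+ n.+1 + horner_mx B (q - 'X^(n.+1)).
  by rewrite rmorphB rmorphXn /= horner_mx_X addrC subrK.
(* Since c A^n l = 1, M^(n+1) l = A^(n+1) l - q(A) l, and the lower terms of q(M) l equal those of
   q(A) l, so everything cancels. *)
rewrite hq mulmxDl Mpoly // exprS -mulmxE -mulmxA Mpow // Mmul cl // eqxx.
rewrite mulmx1 /qA hq mulmxDl exprS -mulmxE -mulmxA.
by rewrite opprD addrA subrr add0r addNr.
Qed.

(** A basis of driven states yields a preliminary feedback [K0] making x_0 = u_0 C cyclic for A + K0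
    C. Ackermann's formula then needs only the single input direction u_0. *)
Lemma pole_placement (F : fieldType) (n m : nat) (A : 'M[F]_n)
    (C : 'M[F]_(m, n)) (q : {poly F}) :
  (forall V : 'M[F]_n, (C <= V)%MS -> (V *m A <= V)%MS -> row_full V) ->
  q \is monic -> size q = n.+1 ->
  exists K : 'M[F]_(n, m), char_poly (A + K *m C) = q.
Proof.
case: n A C => [|n] A C ctrb mq sq.
  have mon1 (p : {poly F}) : p \is monic -> size p = 1%N -> p = 1.
    by move=> /monicP + sp; rewrite [p]size1_polyC ?sp // lead_coefC => ->.
  exists 0; rewrite (mon1 q) //.
  by apply: mon1; [exact: char_poly_monic|exact: size_char_poly].
have [u fX] := driven_free ctrb (leqnn _).
have x0 : driven A C u 0 = u 0%N *m C by [].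
have xS i : driven A C u i.+1 = driven A C u i *m A + u i.+1 *m C by [].
move: (driven A C u) fX x0 xS => x fX x0 xS.
set X := (\matrix_(i < _) _) in fX.
have uX : X \in unitmx by rewrite -row_free_unit.
have xE i (hi : (i < n.+1)%N) : x i = row (Ordinal hi) X by rewrite rowK.
(* Chosen so that x_i K0 = u_(i+1), whence x_i (A + K0 C) = x_(i+1). *)
pose K0 := invmx X *m \matrix_(i < n.+1) u i.+1.
pose A' := A + K0 *m C.
have xA' i : (i <= n)%N -> x i *m A' = x i.+1.
  move=> hi; rewrite /A' mulmxDr xS; congr (_ + _).
  by rewrite (xE _ hi) mulmxA -row_mul /K0 mulmxA mulmxV // mul1mx rowK.
have xpow k : (k <= n.+1)%N -> x 0%N *m A' ^+ k = x k.
  elim: k => [|k IH] hk; first by rewrite expr0 mulmx1.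
  by rewrite exprSr -mulmxE mulmxA IH ?xA' // ltnW.
(* The last vector of the dual basis: x_i l is 1 for i = n and 0 for i < n. *)
pose l : 'cV_n.+1 := invmx X *m delta_mx ord_max 0.
have xl i : (i <= n)%N -> x 0%N *m (A' ^+ i *m l) = (i == n)%:R%:M.
  move=> hi; rewrite mulmxA xpow ?leqW // (xE _ hi) -row_mul /l.
  rewrite mulmxA mulmxV // mul1mx; apply/matrixP => a b.
  by rewrite !mxE !ord1 !eqxx andbT mulr1n.
exists (K0 - horner_mx A' q *m l *m u 0%N).
rewrite -[RHS](char_poly_ackermann xl mq sq); congr (char_poly _).
by rewrite mulmxBl addrA x0 [in RHS]mulmxA.
Qed.

(** If V were proper, its annihilator W would be nonzero, stable under H and killed by G. Over the
    algebraically closed E, H has an eigenvector in W, which the test excludes. *)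
Lemma pbh_controllable (F : fieldType) (E : numClosedFieldType)
    (f : {rmorphism F -> E}) (n m : nat) (H : 'M[F]_n) (G : 'M[F]_(n, m)) :
  (forall (s : E) (v : 'rV[E]_n),
     v *m map_mx f H = s *: v -> v *m map_mx f G = 0 -> v = 0) ->
  forall V : 'M[F]_n, (G^T <= V)%MS -> (V *m H^T <= V)%MS -> row_full V.
Proof.
move=> pbh V /submxP[D GE] /submxP[D' HE].
pose W := kermx V^T.
have WV : W *m V^T = 0 by apply: mulmx_ker.
have WG : W *m G = 0.
  by rewrite -[G]trmxK GE trmx_mul mulmxA WV mul0mx.
have WH : (W *m H <= W)%MS.
  apply/sub_kermxP; rewrite -mulmxA -[H *m _]trmxK trmx_mul trmxK HE.
  by rewrite trmx_mul mulmxA WV mul0mx.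
apply: contraT => nV.
have rW : (0 < \rank W)%N.
  rewrite mxrank_ker mxrank_tr subn_gt0 ltn_neqAle rank_leq_col andbT.
  exact: nV.
have WH' : (map_mx f W *m map_mx f H <= map_mx f W)%MS.
  by rewrite -map_mxM map_submx.
have rW' : (0 < \rank (map_mx f W))%N by rewrite mxrank_map.
(* The eigenvector is found in the coordinates of a basis of W and then carried back to the full
   space. *)
have [s] := eigenvalue_closed (complex.restrict (map_mx f W) (map_mx f H)) rW'.
move=> /eigenvalueP[v /eigenspaceP hv vn0].
move: hv; rewrite eigenspace_restrict // => /eigenspaceP hv.
have WGE : v *m row_base (map_mx f W) *m map_mx f G = 0.
  have /submxP[D2 ->] : (v *m row_base (map_mx f W) <= map_mx f W)%MS.
    by rewrite mulmx_sub // eq_row_base.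
  by rewrite -mulmxA -map_mxM WG map_mx0 mulmx0.
have /eqP := pbh s _ hv WGE.
by rewrite mul_mx_rowfree_eq0 ?row_base_free // (negPf vn0).
Qed.

(** * Spectra as multisets *)

(** The kernel of C is M-stable and H is the map induced on the quotient: completing the rows of C
    to a basis makes M block lower triangular with H as a diagonal block. *)
Lemma char_poly_intertwined (F : fieldType) (p n : nat) (C : 'M[F]_(p, n))
    (M : 'M[F]_n) (H : 'M[F]_p) :
  row_free C -> C *m M = H *m C -> exists q, char_poly M = char_poly H * q.
Proof.
move=> fC; have pn : (p <= n)%N by rewrite -(eqP fC) rank_leq_col.
move: C M fC; rewrite -(subnKC pn); move: (n - p)%N => d C M fC CM.
set U := row_ebase C.
(* C is an invertible matrix times the first p rows of the invertible [U], so the other rows of [U]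
   complete it. *)
have CE : C = col_ebase C *m usubmx U.
  rewrite -[in LHS](mulmx_ebase C) (eqP fC) -mulmxA; congr (_ *m _).
  rewrite -[X in pid_mx p *m X]vsubmxK -/U.
  rewrite (_ : pid_mx p = row_mx 1%:M 0) ?mul_row_col ?mul1mx ?mul0mx ?addr0 //.
  by rewrite pid_mx_row.
pose T := col_mx C (dsubmx U).
have uT : T \in unitmx.
  have -> : T = block_mx (col_ebase C) 0 0 1%:M *m U.
    by rewrite -[U in RHS]vsubmxK mul_block_col !mul0mx mul1mx addr0 add0r -CE.
  rewrite unitmx_mul row_ebase_unit andbT unitmxE det_ublock det1 mulr1.
  rewrite -unitmxE.
  exact: col_ebase_unit.
pose E := dsubmx U *m M *m invmx T.
pose N := block_mx H 0 (lsubmx E) (rsubmx E).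
have TM : T *m M = N *m T.
  rewrite mul_col_mx CM mul_block_col mul0mx addr0; congr (col_mx _ _).
  by rewrite -mul_row_col hsubmxK /E mulmxKV.
exists (char_poly (rsubmx E)).
have -> : char_poly M = char_poly N.
  have TM' :
      map_mx polyC T *m char_poly_mx M = char_poly_mx N *m map_mx polyC T.
    rewrite /char_poly_mx mulmxBl mulmxBr -!map_mxM TM; congr (_ - _).
    by rewrite scalar_mxC.
  have : \det (map_mx polyC T) != 0.
    by rewrite det_map_mx polyC_eq0 -unitfE -unitmxE.
  move/mulfI; apply; rewrite /char_poly -!det_mulmx TM' mulmxE.
  by rewrite det_mulmx mulrC det_mulmx.
rewrite /char_poly /char_poly_mx /N map_block_mx scalar_mx_block.
by rewrite map_mx0 opp_block_mx add_block_mx oppr0 addr0 det_lblock.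
Qed.

Section Spectrum.
Variable R : realType.

(** The characteristic polynomial splits over R[i], so the multiplicities of its roots determine
    it. *)
Lemma eig_isP (n : nat) (M : 'M[R]_n) (L : n.-tuple R[i]) :
  eig_is M L <-> char_poly (to_complex M) = \prod_(a <- L) ('X - a%:P).
Proof.
split=> [eL|cL a]; last by rewrite /alg_mult cL mu_prod_XsubC.
have [r cr] := closed_field_poly_normal (char_poly (to_complex M)).
move: cr; rewrite (monicP (char_poly_monic _)) scale1r => cr.
rewrite cr; apply: perm_big; apply/allP => a _ /=.
by rewrite -eL /alg_mult cr mu_prod_XsubC.
Qed.

Lemma char_poly_eig (n : nat) (M : 'M[R]_n) (L : n.-tuple R[i]) (a : R[i]) :
  eig_is M L -> eigenvalue (to_complex M) a = (a \in L).
Proof. by move=> eL; rewrite -alg_mult_gt0 eL -has_count has_pred1. Qed.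

(** Conjugation permutes the linear factors, hence fixes every coefficient of their product. *)
Lemma self_conjugate_real_poly (p : nat) (L : p.-tuple R[i]) :
  self_conjugate L -> exists q : {poly R},
    [/\ q \is monic, size q = p.+1 &
        map_poly (real_complex R) q = \prod_(a <- L) ('X - a%:P)].
Proof.
move=> sL; set Q := \prod_(a <- L) _.
have QJ : map_poly (@conjc R) Q = Q.
  rewrite rmorph_prod /= -[RHS](perm_big _ sL) big_map; apply: eq_bigr => a _.
  by rewrite rmorphB /= map_polyX map_polyC.
have Qr i : (complex.Re Q`_i)%:C%C = Q`_i.
  have : (map_poly (@conjc R) Q)`_i = Q`_i by rewrite QJ.
  rewrite coef_map /=; case: (Q`_i) => a b [] /eqP.
  by rewrite eq_sym -addr_eq0 -mulr2n mulrn_eq0 /= => /eqP ->.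
have sQ : size Q = p.+1 by rewrite size_prod_XsubC size_tuple.
have mQ : Q \is monic by exact: monic_prod_XsubC.
pose q : {poly R} := \poly_(i < p.+1) complex.Re Q`_i.
have qE : map_poly (real_complex R) q = Q.
  apply/polyP => i; rewrite coef_map coef_poly /=.
  case: ltnP => [_|hi]; first exact: Qr.
  by rewrite rmorph0 nth_default // sQ.
exists q; split=> //.
  by rewrite -(map_monic (real_complex R)) qE.
by rewrite -(size_map_poly (real_complex R)) qE.
Qed.

(** The characteristic polynomial of H divides that of M, so multiplicities can only grow. *)
Lemma eig_contains_intertwined (n p : nat) (C : 'M[R]_(p, n)) (M : 'M[R]_n)
    (H : 'M[R]_p) (L : p.-tuple R[i]) :
  row_free C -> C *m M = H *m C -> eig_is H L -> eig_contains M L.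
Proof.
move=> fC CM eL a; rewrite -eL /alg_mult.
have fC' : row_free (to_complex C) by rewrite /row_free mxrank_map.
have CM' : to_complex C *m to_complex M = to_complex H *m to_complex C.
  by rewrite /to_complex -!map_mxM CM.
have [q qE] := char_poly_intertwined fC' CM'.
have cM0 : char_poly (to_complex M) != 0 by rewrite monic_neq0 ?char_poly_monic.
rewrite mup_geq // qE dvdp_mulr //.
by rewrite -mup_geq // monic_neq0 // char_poly_monic.
Qed.

Lemma controllable_placement (n m : nat) (H : 'M[R]_n) (G : 'M[R]_(n, m))
    (L : n.-tuple R[i]) :
  (forall s, \rank (row_mx (s%:M - to_complex H) (to_complex G)) = n) ->
  self_conjugate L -> exists Z : 'M[R]_(m, n), eig_is (H - G *m Z) L.
Proof.
move=> pbh sL; have [q [mq sq qE]] := self_conjugate_real_poly sL.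
have ctrb : forall V : 'M[R]_n,
    (G^T <= V)%MS -> (V *m H^T <= V)%MS -> row_full V.
  apply: (@pbh_controllable _ _ (real_complex R)) => s v vH vG.
  (* Full row rank says that no nonzero row v satisfies both v H = s v and v G = 0. *)
  have fr : row_free (row_mx (s%:M - to_complex H) (to_complex G)).
    by rewrite /row_free pbh.
  apply/eqP; rewrite -(mul_mx_rowfree_eq0 _ fr) mul_mx_row mulmxBr vH vG.
  by rewrite mul_mx_scalar subrr row_mx0.
have [K cK] := pole_placement ctrb mq sq.
(* H - G Z is the transpose of H^T + K G^T, which has the same characteristic polynomial. *)
exists (- K^T); apply/eig_isP; rewrite -qE -cK /to_complex -map_char_poly.
congr (map_poly _ _); rewrite -char_poly_trmx; congr (char_poly _).
by rewrite mulmxN opprK linearD /= trmx_mul trmxK.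
Qed.

End Spectrum.

(** * Linear differential equations *)

Section LinearODE.
Variable R : realType.

Lemma is_derive_mulmx (n p : nat) (C : 'M[R]_(p, n)) (x f : R -> 'cV[R]_n)
    (t : R) (i : 'I_p) :
  (forall j, is_derive t (1 : R) (fun s : R => x s j 0) (f t j 0)) ->
  is_derive t (1 : R) (fun s : R => (C *m x s) i 0) ((C *m f t) i 0).
Proof.
move=> dx.
have -> : (fun s : R => (C *m x s) i 0) =
    \sum_(j < n) (C i j \*: (fun s : R => x s j 0)).
  by apply/funext => s; rewrite mxE fct_sumE.
by rewrite mxE; apply: is_derive_sum => j; exact: is_deriveZ.
Qed.

Lemma solves_from_mulmx (n p : nat) (C : 'M[R]_(p, n)) (t0 : R)
    (x f : R -> 'cV[R]_n) :
  solves_from t0 x f -> solves_from t0 (fun t => C *m x t) (fun t => C *m f t).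
Proof.
move=> sx i; split=> [|t tt0]; last first.
  by apply: is_derive_mulmx => j; have [_] := sx j; exact.
have -> : (fun s : R => (C *m x s) i 0) =
    (fun s => \sum_(j < n) C i j * x s j 0).
  by apply/funext => s; rewrite mxE.
apply: continuous_big => [|j _ t].
  exact: add_continuous.
have [cj _] := sx j.
by apply: cvgM; [exact: cvg_cst|exact: cj].
Qed.

(** The Taylor coefficients in t of the i-th entry of exp(tM) x0. *)
Let coef (n : nat) (M : 'M[R]_n) (x0 : 'cV[R]_n) (i : 'I_n) (k : nat) : R :=
  (iter k (mulmx M) x0) i 0 / k`!%:R.

Let diffs_coef n M x0 i : pseries_diffs (@coef n M x0 i) = coef M (M *m x0) i.
Proof.
apply/funext => k; rewrite /pseries_diffs /coef iterSr factS natrM invfM.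
by rewrite mulrCA mulVKf // pnatr_eq0.
Qed.

(** The sum of all absolute entries of M serves as a crude operator norm; the geometric bound lets
    an exponential series dominate. *)
Let iter_bound n (M : 'M[R]_n) (x0 : 'cV[R]_n) k i :
  `|(iter k (mulmx M) x0) i 0| <=
  (\sum_i `|x0 i 0|) * (\sum_i \sum_j `|M i j|) ^+ k.
Proof.
elim: k i => [|k IH] i /=.
  by rewrite mulr1 (bigD1 i) //= lerDl sumr_ge0.
rewrite mxE; apply: le_trans (ler_norm_sum _ _ _) _; rewrite exprS mulrCA.
set B := _ * _ ^+ _ in IH *; have B0 : 0 <= B by rewrite (le_trans _ (IH i)).
have ci : \sum_j `|M i j| <= \sum_i \sum_j `|M i j|.
  by rewrite [leRHS](bigD1 i) //= lerDl sumr_ge0 // => *; rewrite sumr_ge0.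
apply: le_trans (ler_wpM2r B0 ci); rewrite mulr_suml; apply: ler_sum => j _.
by rewrite normrM ler_wpM2l.
Qed.

Let coef_cvg n M x0 i (t : R) : cvgn (pseries (@coef n M x0 i) t).
Proof.
apply: normed_cvg.
set K := \sum_i `|x0 i 0|; set c := \sum_i \sum_j `|M i j|.
have c0 : 0 <= c by rewrite sumr_ge0 // => *; rewrite sumr_ge0.
have K0 : 0 <= K by rewrite sumr_ge0.
apply: (@series_le_cvg _ _ (K *: exp_coeff (c * `|t|))).
- by move=> k; rewrite normr_ge0.
- by move=> k; rewrite mulr_ge0 // exp_coeff_ge0 // mulr_ge0.
- move=> k; rewrite -[leRHS]/(K * ((c * `|t|) ^+ k / k`!%:R)) /coef /=.
  rewrite !normrM normfV normr_nat normrX mulrAC [leRHS]mulrA ler_wpM2r //.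
  by rewrite exprMn [leRHS]mulrA ler_wpM2r ?exprn_ge0 // iter_bound.
- exact/is_cvg_seriesZ/is_cvg_series_exp_coeff.
Qed.

(** The solution is exp((t - t1) M) x1, defined on the whole line. It lets a property of all
    trajectories be tested at every state vector. *)
Lemma linear_ode_solution (n : nat) (M : 'M[R]_n) (t1 : R) (x1 : 'cV[R]_n) :
  exists x : R -> 'cV[R]_n,
    x t1 = x1 /\ forall t0, solves_from t0 x (fun t => M *m x t).
Proof.
pose e y0 (t : R) : 'cV[R]_n := \col_i limn (pseries (coef M y0 i) t).
have eM y0 t : e (M *m y0) t = M *m e y0 t.
  apply/colP => i; rewrite !mxE.
  have -> : pseries (coef M (M *m y0) i) t =
      fun N => \sum_j M i j * pseries (coef M y0 j) t N.
    apply/funext => N; rewrite /pseries /series /=.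
    under [RHS]eq_bigr do rewrite mulr_sumr.
    rewrite exchange_big; apply: eq_bigr => k _ /=.
    rewrite /coef -iterSr iterS mxE !mulr_suml; apply: eq_bigr => j _.
    by rewrite !mulrA.
  apply: cvg_lim => //; apply: cvg_big => //; first exact: add_continuous.
  move=> j _; rewrite mxE; apply: cvgM; first exact: cvg_cst.
  exact: coef_cvg.
have e0 y0 : e y0 0 = y0.
  apply/colP => i; rewrite mxE; apply: lim_near_cst => //.
  near=> N; rewrite -[N]prednK; last by near: N; exists 1%N.
  rewrite /pseries /series /= big_nat_recl // big1 ?addr0 => [|k _].
    by rewrite /coef /= fact0 divr1 mulr1.
  by rewrite exprS mul0r mulr0.
have de y0 t i : is_derive t (1 : R) (fun s => e y0 s i 0) ((M *m e y0 t) i 0).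
  rewrite -eM mxE -diffs_coef.
  have -> : (fun s => e y0 s i 0) = fun s => limn (pseries (coef M y0 i) s).
    by apply/funext => s; rewrite mxE.
  (* Differentiated series have again the form [coef], so all of them converge at |t| + 1, a point
     beyond |t|. *)
  apply: (@pseries_snd_diffs _ _ (`|t| + 1)); rewrite ?diffs_coef //.
  by rewrite [ltRHS]ger0_norm ?addr_ge0 // ltrDl.
have dx t i : is_derive t (1 : R) (fun s => e x1 (s - t1) i 0)
    ((M *m e x1 (t - t1)) i 0).
  have := @is_derive1_comp _ (fun s => e x1 s i 0) (shift (- t1)) t _ _
    (de x1 _ i) (is_derive_shift _ _ _).
  by rewrite mulr1.
exists (fun t => e x1 (t - t1)); split; first by rewrite subrr e0.
move=> t0 i; split=> [|t _]; last exact: dx.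
apply: continuous_subspaceT => t.
by apply/differentiable_continuous/derivable1_diffP; have [] := dx t i.
Unshelve. all: by end_near. Qed.

End LinearODE.

(** * Decay of stable linear systems at a prescribed rate *)

Section Decay.
Variable R : realType.

(** Once |h| < s eps/2, the function exp(s t) (N - eps/2) is nonincreasing, which keeps N below eps
    at large times. *)
Lemma gronwall_vanish (N dN h : R -> R) (s t0 : R) :
  0 < s -> (forall t, t0 < t -> is_derive t (1 : R) N (dN t)) ->
  (forall t, t0 < t -> dN t <= - s * N t + h t) -> (forall t, 0 <= N t) ->
  h @ +oo --> (0 : R) -> N @ +oo --> (0 : R).
Proof.
move=> s0 dNE dNle N0 h0; apply/cvgr0Pnorm_lt => eps eps0.
have [M [_ hM]] : \forall t \near +oo, `|h t| < s * (eps / 2).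
  by apply: cvgr0_norm_lt => //; rewrite !mulr_gt0.
pose T := Num.max M t0 + 1.
have [TM Tt0] : M < T /\ t0 < T.
  by split; rewrite /T ltr_pwDr // le_max lexx ?orbT.
pose g t := expR (s * t) * (N t - eps / 2).
have dg t : T <= t -> is_derive t (1 : R) g
    (s * expR (s * t) * (N t - eps / 2) + expR (s * t) * dN t).
  move=> Tt; have dNt := dNE t (lt_le_trans Tt0 Tt).
  have de : is_derive t (1 : R) (fun t => expR (s * t)) (expR (s * t) * s).
    apply: (@is_derive1_comp _ expR ( *%R s)); apply: is_derive_eq.
    by rewrite /GRing.scale /= mulr1.
  have db : is_derive t (1 : R) (fun t => N t - eps / 2) (dN t).
    by apply: is_derive_eq; rewrite subr0.
  apply: (@is_derive_eq _ _ _ _ _ _ _ _ (is_deriveM de db)).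
  by rewrite /GRing.scale /=; ring.
have g_le t : T <= t -> g t <= g T.
  move=> Tt; apply: (@ler0_derive1_nincry _ g T) => //.
  - move=> x; rewrite in_itv /= andbT => /ltW Tx; by have [] := dg x Tx.
  - move=> x; rewrite in_itv /= andbT => /ltW Tx.
    rewrite derive1E; have [_ ->] := dg x Tx.
    have := dNle x (lt_le_trans Tt0 Tx).
    have /ltW := hM x (lt_le_trans TM Tx); rewrite ler_norml => /andP[_ h1] h2.
    have e0 := expR_gt0 (s * x).
    rewrite [s * _]mulrC -mulrA -mulrDr pmulr_rle0 //.
    by lra.
  - apply: derivable_within_continuous => x; rewrite in_itv /= andbT => Tx.
    by have [] := dg x Tx.
(* Beyond [T'], |g T| < s t eps/2 < exp(s t) eps/2 by exp(x) >= 1 + x, whereas N t >= eps would give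
   exp(s t) eps/2 <= g t <= |g T|. *)
pose T' := Num.max T (`|g T| / (s * (eps / 2))).
exists T'; split; first exact: num_real.
move=> t; rewrite gt_max => /andP[Tt]; rewrite ltr_pdivrMr ?mulr_gt0 // => Gt.
have gt := le_trans (g_le t (ltW Tt)) (ler_norm _).
have e1 := expR_ge1Dx (s * t).
rewrite ger0_norm // ltNge; apply/negP => eN.
have : expR (s * t) * (eps / 2) <= g t.
  by rewrite /g ler_pM2l ?expR_gt0 //; lra.
apply/negP; rewrite -ltNge; apply: le_lt_trans gt _; apply: lt_le_trans Gt _.
rewrite mulrA ler_pM2r ?divr_gt0 // mulrC; lra.
Qed.

(* The real and imaginary parts of w' = (a + ib) w + g; by Young's inequality,
   N = |w|^2 satisfies N' <= a N - |g|^2 / a. *)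
Lemma damped_rotation_vanish (u v g1 g2 : R -> R) (a b t0 : R) :
  a < 0 ->
  (forall t, t0 < t -> is_derive t (1 : R) u (a * u t - b * v t + g1 t)) ->
  (forall t, t0 < t -> is_derive t (1 : R) v (a * v t + b * u t + g2 t)) ->
  g1 @ +oo --> (0 : R) -> g2 @ +oo --> (0 : R) ->
  u @ +oo --> (0 : R) /\ v @ +oo --> (0 : R).
Proof.
move=> a0 du dv g10 g20.
pose N t := u t * u t + v t * v t.
have N0 : N @ +oo --> (0 : R).
  have sa0 : 0 < - a by lra.
  apply: (@gronwall_vanish N
    (fun t => 2 * a * N t + 2 * (u t * g1 t + v t * g2 t))
    (fun t => (- a)^-1 * (g1 t * g1 t + g2 t * g2 t)) (- a) t0) => //.
  - move=> t tt0; have dut := du t tt0; have dvt := dv t tt0.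
    have dN := is_deriveD (is_deriveM dut dut) (is_deriveM dvt dvt).
    apply: (@is_derive_eq _ _ _ _ _ _ _ _ dN).
    by rewrite /GRing.scale /= /N; ring.
  - move=> t _; have q x y : 2 * (x * y) <= - a * (x * x) + (- a)^-1 * (y * y).
      have -> : - a * (x * x) + (- a)^-1 * (y * y) =
          - a * (x - (- a)^-1 * y) ^+ 2 + 2 * (x * y).
        by field; rewrite lt_eqF.
      by rewrite lerDr mulr_ge0 ?sqr_ge0 // ltW.
    have := q (u t) (g1 t); have := q (v t) (g2 t); rewrite /N; lra.
  - by move=> t; rewrite addr_ge0 // -expr2 sqr_ge0.
  - rewrite [X in _ --> X](_ : 0 = (- a)^-1 * (0 * 0 + 0 * 0) :> R);
      last by ring.
    by apply: cvgM; [exact: cvg_cst|apply: cvgD; apply: cvgM].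
have sq (w : R -> R) : (forall t, w t * w t <= N t) -> w @ +oo --> (0 : R).
  move=> wN; apply/cvgr0Pnorm_lt => eps eps0; near=> t.
  rewrite -ltr_sqr ?nnegrE ?normr_ge0 ?(ltW eps0) // real_normK ?num_real //.
  rewrite expr2; apply: le_lt_trans (wN t) _; apply: le_lt_trans (ler_norm _) _.
  by near: t; apply: cvgr0_norm_lt => //; rewrite exprn_gt0.
by split; apply: sq => t; rewrite /N ?lerDl ?lerDr -expr2 sqr_ge0.
Unshelve. all: by end_near. Qed.

Let ReD (x y : R[i]) : complex.Re (x + y) = complex.Re x + complex.Re y.
Proof. by case: x y => a b []. Qed.

Let ImD (x y : R[i]) : complex.Im (x + y) = complex.Im x + complex.Im y.
Proof. by case: x y => a b []. Qed.

Lemma Re_mul_to_complex (n : nat) (v : 'rV[R[i]]_n) (z : 'cV[R]_n) :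
  complex.Re ((v *m to_complex z) 0 0) = (map_mx (@complex.Re R) v *m z) 0 0.
Proof.
rewrite !mxE (big_morph _ ReD (erefl _)); apply: eq_bigr => j _.
by rewrite !mxE; case: (v 0 j) => a b /=; rewrite mulr0 subr0.
Qed.

Lemma Im_mul_to_complex (n : nat) (v : 'rV[R[i]]_n) (z : 'cV[R]_n) :
  complex.Im ((v *m to_complex z) 0 0) = (map_mx (@complex.Im R) v *m z) 0 0.
Proof.
rewrite !mxE (big_morph _ ImD (erefl _)); apply: eq_bigr => j _.
by rewrite !mxE; case: (v 0 j) => a b /=; rewrite mulr0 add0r.
Qed.

Lemma is_derive_expRM (r t df : R) (f : R -> R) :
  is_derive t (1 : R) f df ->
  is_derive t (1 : R) (fun s => expR (r * s) * f s)
    (r * (expR (r * t) * f t) + expR (r * t) * df).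
Proof.
move=> dft.
have de : is_derive t (1 : R) (fun t => expR (r * t)) (expR (r * t) * r).
  apply: (@is_derive1_comp _ expR ( *%R r)); apply: is_derive_eq.
  by rewrite /GRing.scale /= mulr1.
apply: (@is_derive_eq _ _ _ _ _ _ _ _ (is_deriveM de dft)).
by rewrite /GRing.scale /=; ring.
Qed.

(** Induction on [s] for all v: w = v y satisfies w' = a w + v (H - a) y, where the forcing term
    vanishes by induction. For empty [s], v itself is 0. *)
Lemma functional_vanish (n : nat) (H : 'M[R]_n) (t0 r : R) (y : R -> 'cV[R]_n)
    (s : seq R[i]) (v : 'rV[R[i]]_n) :
  solves_from t0 y (fun t => H *m y t) ->
  (forall a, a \in s -> complex.Re a < - r) ->
  foldl (fun w a => w *m (to_complex H - a%:M)) v s = 0 ->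
  (fun t => expR (r * t) * complex.Re ((v *m to_complex (y t)) 0 0)) @ +oo
    --> (0 : R) /\
  (fun t => expR (r * t) * complex.Im ((v *m to_complex (y t)) 0 0)) @ +oo
    --> (0 : R).
Proof.
move=> sy; elim: s v => [|a s IH] v sr /=.
  move=> ->; split; apply: cvg_near_cst; near=> t.
    by rewrite mul0mx mxE /= mulr0.
  by rewrite mul0mx mxE /= mulr0.
move=> /IH[|g1 g2]; first by move=> b bs; apply: sr; rewrite in_cons bs orbT.
have ar := sr a (mem_head _ _).
have vH t : (v *m to_complex (H *m y t)) 0 0 =
    (v *m (to_complex H - a%:M) *m to_complex (y t)) 0 0 +
    a * (v *m to_complex (y t)) 0 0.
  have -> : v *m to_complex (H *m y t) =
      v *m (to_complex H - a%:M) *m to_complex (y t) +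
      a *: (v *m to_complex (y t)).
    rewrite /to_complex map_mxM mulmxBr mulmxBl mulmxA mul_mx_scalar scalemxAl.
    by rewrite subrK.
  by rewrite [LHS]mxE [X in _ + X]mxE.
have dRe t : t0 < t -> is_derive t (1 : R)
    (fun s => complex.Re ((v *m to_complex (y s)) 0 0))
    (complex.Re ((v *m to_complex (H *m y t)) 0 0)).
  move=> tt0; under eq_fun do rewrite Re_mul_to_complex.
  rewrite Re_mul_to_complex.
  apply: (@is_derive_mulmx _ _ _ _ _ (fun t => H *m y t)).
  by move=> j; have [_] := sy j; exact.
have dIm t : t0 < t -> is_derive t (1 : R)
    (fun s => complex.Im ((v *m to_complex (y s)) 0 0))
    (complex.Im ((v *m to_complex (H *m y t)) 0 0)).
  move=> tt0; under eq_fun do rewrite Im_mul_to_complex.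
  rewrite Im_mul_to_complex.
  apply: (@is_derive_mulmx _ _ _ _ _ (fun t => H *m y t)).
  by move=> j; have [_] := sy j; exact.
(* The weight exp(r t) shifts the eigenvalue a to a + r, whose real part is negative. *)
apply: (@damped_rotation_vanish _ _ _ _ (r + complex.Re a) (complex.Im a) t0
  _ _ _ g1 g2).
- by lra.
- move=> t tt0; apply: is_derive_eq; first apply: is_derive_expRM.
    exact: dRe.
  rewrite vH ReD.
  case: (a) ((v *m to_complex (y t)) 0 0) => a1 a2 [w1 w2] /=.
  by set X := complex.Re _; ring.
- move=> t tt0; apply: is_derive_eq; first apply: is_derive_expRM.
    exact: dIm.
  rewrite vH ImD.
  case: (a) ((v *m to_complex (y t)) 0 0) => a1 a2 [w1 w2] /=.
  by set X := complex.Im _; ring.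
Unshelve. all: by end_near. Qed.

(** Cayley-Hamilton: the product of the factors H - a over the spectrum is the characteristic
    polynomial evaluated at H. *)
Lemma eig_is_foldl (n : nat) (H : 'M[R]_n) (L : n.-tuple R[i])
    (v : 'rV[R[i]]_n) :
  eig_is H L -> foldl (fun w a => w *m (to_complex H - a%:M)) v L = 0.
Proof.
case: n H L v => [|n] H L v; first by move=> _; rewrite thinmx0.
move=> /eig_isP cH.
suff gen (s : seq R[i]) (w : 'rV_n.+1) :
    foldl (fun w a => w *m (to_complex H - a%:M)) w s =
    w *m horner_mx (to_complex H) (\prod_(a <- s) ('X - a%:P)).
  by rewrite gen -cH Cayley_Hamilton mulmx0.
elim: s w => [|a s IH] w /=; first by rewrite big_nil rmorph1 mulmx1.
rewrite IH big_cons rmorphM /= rmorphB /= horner_mx_X horner_mx_C.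
by rewrite -mulmxE mulmxA.
Qed.

Lemma stable_vanishes_at_rate (n : nat) (H : 'M[R]_n) (L : n.-tuple R[i])
    (t0 r : R) (y : R -> 'cV[R]_n) :
  0 < r -> eig_is H L -> (forall a, a \in L -> complex.Re a < - r) ->
  solves_from t0 y (fun t => H *m y t) -> vanishes_at_rate r y.
Proof.
move=> r0 eL Lr sy i.
(* With the i-th coordinate as functional, q = r gives the weighted limit and q = 0 the plain
   one. *)
have key (q : R) : (forall a, a \in L -> complex.Re a < - q) ->
    (fun t => expR (q * t) * y t i 0) @ +oo --> (0 : R).
  move=> Lq; have Hi := eig_is_foldl (delta_mx 0 i) eL.
  have [+ _] := functional_vanish sy Lq Hi.
  apply: cvg_trans; apply: near_eq_cvg; near=> t.
  by rewrite -rowE !mxE.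
split; last exact: key.
have : (fun t => expR (0 * t) * y t i 0) @ +oo --> (0 : R).
  by apply: key => a /Lr /lt_le_trans; apply; lra.
apply: cvg_trans; apply: near_eq_cvg; near=> t.
by rewrite mul0r expR0 mul1r.
Unshelve. all: by end_near. Qed.

End Decay.

(** * Static output feedback *)

Section OutputFeedback.
Variables (R : realType) (n m p : nat).
Variables (A : 'M[R]_n) (B : 'M[R]_(n, m)) (C : 'M[R]_(p, n)).
Variable Cm : 'M[R]_(n, p).
Hypothesis fC : row_free C.
Hypothesis CCm : C *m Cm = 1%:M.

Lemma sof_trajectoryE (Z : 'M[R]_(m, p)) (t0 : R) (x : R -> 'cV[R]_n) :
  sof_trajectory A B C Z t0 x <->
  solves_from t0 x (fun t => (A - B *m Z *m C) *m x t).
Proof.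
rewrite /sof_trajectory /trajectory.
suff -> : (fun t => A *m x t + B *m - (Z *m (C *m x t))) =
          (fun t => (A - B *m Z *m C) *m x t) by [].
by apply/funext => t; rewrite mulmxBl mulmxN !mulmxA.
Qed.

Lemma output_subsystemP (Z : 'M[R]_(m, p)) (H : 'M[R]_p) :
  output_subsystem A B C Z H <-> C *m (A - B *m Z *m C) = H *m C.
Proof.
split=> [oH|CH t0 x /sof_trajectoryE sx]; last first.
  have := solves_from_mulmx C sx.
  suff -> : (fun t => C *m ((A - B *m Z *m C) *m x t)) =
      (fun t => H *m (C *m x t)) by [].
  by apply/funext => t; rewrite mulmxA CH mulmxA.
have key x1 : C *m (A - B *m Z *m C) *m x1 = H *m C *m x1 :> 'cV_p.
  (* The state is prescribed at time 1, after the initial time 0, because derivatives are available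
     only for t > t0. *)
  have [x [<- sx]] := linear_ode_solution (A - B *m Z *m C) 1 x1.
  have sH := oH 0 x ((sof_trajectoryE _ _ _).2 (sx 0)).
  have sM := solves_from_mulmx C (sx 0).
  apply/colP => i; have [_ /(_ 1 ltr01) dH] := sH i.
  have [_ /(_ 1 ltr01) dM] := sM i.
  have [_ eH] := dH; have [_ eM] := dM.
  by move: eM; rewrite eH !mulmxA => ->.
apply/matrixP => i j; have /colP/(_ i) := key (delta_mx j 0).
by rewrite -!colE !mxE.
Qed.

Lemma output_matrix_unique (H : 'M[R]_p) :
  C *m A = H *m C -> H = C *m A *m Cm.
Proof. by move=> ->; rewrite -mulmxA CCm mulmx1. Qed.

Lemma closed_output (Z : 'M[R]_(m, p)) (H : 'M[R]_p) :
  C *m A = C *m A *m Cm *m C ->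
  C *m (A - B *m Z *m C) = H *m C <-> H = C *m A *m Cm - C *m B *m Z.
Proof.
move=> CA; have E : C *m (A - B *m Z *m C) = (C *m A *m Cm - C *m B *m Z) *m C.
  by rewrite mulmxBl -CA mulmxBr !mulmxA.
by rewrite E; split=> [/(row_free_inj fC)|->].
Qed.

(** The first condition puts the rows of CA in the row space of C. Then (sC - CA, CB) is (s - H0,
    CB) times diag(C, 1), a factor of full row rank, which preserves the rank. *)
Lemma rank_conditionsP :
  rank_conditions A B C <->
  C *m A = C *m A *m Cm *m C /\
  forall s : R[i], \rank (row_mx (s%:M - to_complex (C *m A *m Cm))
                                 (to_complex (C *m B))) = p.
Proof.
have r1 : \rank (col_mx (C *m A) C) = \rank C <-> C *m A = C *m A *m Cm *m C.
  rewrite -addsmxE.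
  have h := mxrank_leqif_sup (addsmxSr (C *m A) C).
  split=> [/esym/eqP|CA].
    rewrite h addsmx_sub => /andP[/submxP[D CA] _].
    by rewrite {1}CA (output_matrix_unique CA).
  apply/esym/eqP; rewrite h addsmx_sub submx_refl andbT CA.
  by rewrite submxMl.
have r2 : C *m A = C *m A *m Cm *m C -> forall s,
    \rank (row_mx (s *: to_complex C - to_complex (C *m A))
      (to_complex (C *m B))) =
    \rank (row_mx (s%:M - to_complex (C *m A *m Cm)) (to_complex (C *m B))).
  move=> CA s; pose D := block_mx (to_complex C) 0 0 (1%:M : 'M[R[i]]_m).
  have fD : row_free D.
    apply/row_freeP; exists (block_mx (to_complex Cm) 0 0 1%:M).
    rewrite mulmx_block !mul0mx !mulmx0 mulmx1 !addr0 add0r.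
    by rewrite -map_mxM CCm map_mx1 -scalar_mx_block.
  rewrite -(mxrankMfree _ fD); congr (\rank _).
  rewrite mul_row_block !mulmx0 mulmx1 addr0 add0r mulmxBl mul_scalar_mx.
  by rewrite -map_mxM -CA.
split=> [[/r1 CA h]|[CA h]].
  by split=> // s; have [+ E] := h s; rewrite r2 // E.
by split; [apply/r1|move=> s; rewrite r2 // h (eqP fC)].
Qed.

(** The subsystem matrix is forced to be H0 - CBZ, and the decay follows from its spectrum. *)
Lemma sof_placesP (Z : 'M[R]_(m, p)) (L : p.-tuple R[i]) :
  C *m A = C *m A *m Cm *m C ->
  sof_places A B C Z L <-> eig_is (C *m A *m Cm - C *m B *m Z) L.
Proof.
move=> CA; split=> [[[H [/output_subsystemP/(closed_output _ _ CA) ->]]]//|eL].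
have oH : output_subsystem A B C Z (C *m A *m Cm - C *m B *m Z).
  exact/output_subsystemP/closed_output.
split=> [|r r0 Lr t0 x sx]; first by exists (C *m A *m Cm - C *m B *m Z).
exact: (stable_vanishes_at_rate r0 eL Lr (oH t0 x sx)).
Qed.

Lemma assignable_rank_conditions :
  sof_assignable A B C -> rank_conditions A B C.
Proof.
move=> as_; apply/rank_conditionsP.
(* Constant real spectra already suffice for necessity. *)
have real_sc (c : R) : self_conjugate (nseq_tuple p c%:C%C).
  by rewrite /self_conjugate /= map_nseq conjc_real.
have CA : C *m A = C *m A *m Cm *m C.
  have [Z [[H [/output_subsystemP CH _]] _]] := as_ _ (real_sc 0).
  have CA : C *m A = (H + C *m B *m Z) *m C.
    by rewrite mulmxDl -CH mulmxBr !mulmxA subrK.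
  by rewrite {1}CA (output_matrix_unique CA).
split=> // s; apply/eqP; apply: contraT => nf.
(* A nonzero v in the left kernel satisfies v H0 = s v and v CB = 0, so s is an eigenvalue of H0 -
   CBZ for every Z. *)
have : kermx (row_mx (s%:M - to_complex (C *m A *m Cm))
    (to_complex (C *m B))) != 0.
  by rewrite kermx_eq0.
move/rowV0Pn => [v /sub_kermxP + v0].
rewrite mul_mx_row -[0]row_mx0 => /eq_row_mx[/eqP + vG].
rewrite mulmxBr mul_mx_scalar subr_eq0 => /eqP vH.
(* A real number different from s: 1 if s = 0, and 0 otherwise. Placing all poles at c contradicts
   the fixed eigenvalue s. *)
pose c : R := (s == 0)%:R.
have sc : s != c%:C%C.
  rewrite /c; case: (eqVneq s 0) => [->|]; rewrite ?rmorph1 ?rmorph0 //.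
  by rewrite eq_sym oner_eq0.
have [Z /(sof_placesP _ _ CA) eL] := as_ _ (real_sc c).
have : eigenvalue (to_complex (C *m A *m Cm - C *m B *m Z)) s.
  apply/eigenvalueP; exists v => //.
  rewrite /to_complex map_mxB mulmxBr -/(to_complex _) -vH map_mxM mulmxA.
  by rewrite -/(to_complex (C *m B)) vG mul0mx subr0.
by rewrite (char_poly_eig _ eL) => /nseqP[/eqP]; rewrite (negPf sc).
Qed.

End OutputFeedback.

Theorem corollary3 (R : realType) (n m p : nat) (A : 'M[R]_n)
  (B : 'M[R]_(n, m)) (C : 'M[R]_(p, n)) (Cm : 'M[R]_(n, p))
  (hC : row_free C) (hCm : is_ginv C Cm) :
  (sof_assignable A B C <-> rank_conditions A B C) /\
  (rank_conditions A B C ->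
   forall L : p.-tuple R[i], self_conjugate L ->
     (exists Z : 'M[R]_(m, p),
        eig_is (C *m A *m Cm - C *m B *m Z) L) /\
     (forall Z : 'M[R]_(m, p),
        sof_places A B C Z L <->
        eig_is (C *m A *m Cm - C *m B *m Z) L) /\
     (forall Z : 'M[R]_(m, p),
        eig_is (C *m A *m Cm - C *m B *m Z) L ->
        eig_contains (A - B *m Z *m C) L)).
Proof.
(* C C^- C = C, and C cancels on the right by its full row rank. *)
have CCm : C *m Cm = 1%:M.
  by apply: (row_free_inj hC); rewrite mul1mx.
split; first split; first exact: assignable_rank_conditions CCm.
- move=> /(rank_conditionsP A B hC CCm)[CA pbh] L sL.
  have [Z eZ] := controllable_placement pbh sL.
  by exists Z; apply/(sof_placesP B hC Z L CA).
move=> /(rank_conditionsP A B hC CCm)[CA pbh] L sL; split; last split.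
- exact: controllable_placement.
- by move=> Z; exact: sof_placesP.
- move=> Z; apply: (eig_contains_intertwined hC).
  exact/(closed_output B hC _ _ CA).
Qed.
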